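(* For any $\delta>0$ and any integer $\ell>0$ there exists an integer $T=T(\delta,\ell)>0$ such that for any matrix $A$ (of any size) over any field $\mathbb F$ the following is true: with $\boldsymbol\theta\in\{1,\dots,T\}$ chosen uniformly at random, $$\Pr\bigl[A[\boldsymbol\theta]\text{ is }(\delta,\ell)\text{-free}\bigr]>1-\delta.$$
   Context: For an integer $n\ge1$ let $[n]=\{1,\dots,n\}$. For a vector $\xi$ indexed by a set $U$, $\operatorname{supp}(\xi)=\{i\in U:\xi_i\ne0\}$. Let $A$ be an $m\times n$ matrix over a field $\mathbb F$. - A set $\emptyset\ne I\subseteq[n]$ is a relation of $A$ if there is a row vector $y\in\mathbb F^{1\times m}$ with $\emptyset\ne\operatorname{supp}(yA)\subseteq I$. - If $I=\{i\}$ is a relation of $A$, then $i$ is called frozen in $A$; $\mathfrak F(A)$ is the set of all frozen $i\in[n]$. - A set $I\subseteq[n]$ is a proper relation of $A$ if $I\setminus\mathfrak F(A)$ is a relation of $A$. - For $\delta>0$, $\ell\ge1$, $A$ is $(\delta,\ell)$-free if there are no more than $\delta n^\ell$ proper relations $I\subseteq[n]$ of size $|I|=\ell$. Random perturbation: for an integer $\theta\ge0$ let $\mathbf i_1,\dots,\mathbf i_\theta\in[n]$ be uniformly random and mutually independent column indices. The matrix $A[\theta]$ is obtained by adding $\theta$ new rows to $A$ such that for each $j\in[\theta]$ the $j$-th new row has precisely one non-zero entry, namely a one in column $\mathbf i_j$. The random number $\boldsymbol\theta$ is independent of the indices $\mathbf i_1,\mathbf i_2,\dots$ *)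

(* Defs.v *)
From mathcomp Require Import all_boot all_order all_algebra.
From mathcomp Require Import boolp reals.

Set Implicit Arguments.
Unset Strict Implicit.
Unset Printing Implicit Defensive.

Import Order.TTheory GRing.Theory Num.Theory.
Local Open Scope ring_scope.

Definition supp (F : fieldType) (n : nat) (xi : 'rV[F]_n) : {set 'I_n} :=
  [set i | xi ord0 i != 0].

(* Non-emptiness of [I] is implied by the condition on [supp (y *m A)]. *)
Definition is_relation (F : fieldType) (m n : nat) (A : 'M[F]_(m, n))
    (I : {set 'I_n}) : bool :=
  `[< I != set0 /\
      exists y : 'rV[F]_m,
        supp (y *m A) != set0 /\ supp (y *m A) \subset I >].

Definition frozen (F : fieldType) (m n : nat) (A : 'M[F]_(m, n)) :
    {set 'I_n} :=
  [set i | is_relation A [set i]].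

Definition proper_relation (F : fieldType) (m n : nat) (A : 'M[F]_(m, n))
    (I : {set 'I_n}) : bool :=
  is_relation A (I :\: frozen A).

Definition is_free (R : realType) (delta : R) (l : nat) (F : fieldType)
    (m n : nat) (A : 'M[F]_(m, n)) : bool :=
  #|[set I : {set 'I_n} | proper_relation A I & #|I| == l]|%:R
    <= delta * n%:R ^+ l.

Definition perturb (F : fieldType) (m n : nat) (A : 'M[F]_(m, n))
    (theta : nat) (i : 'I_theta -> 'I_n) : 'M[F]_(m + theta, n) :=
  col_mx A (\matrix_(j, k) (k == i j)%:R).

(* The uniform distribution on the product {1..T} x [n]^T is the joint law of
   a uniform theta and independent uniform indices i_1, ..., i_T, with theta
   independent of the indices; since theta <= T, no further index is used. *)
Definition outcome (T n : nat) : finType :=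
  ('I_T * {ffun 'I_T -> 'I_n})%type.

(* Elements of ['I_T] are 0, ..., T - 1, hence the shift. *)
Definition theta_of (T n : nat) (w : outcome T n) : nat := (w.1 : 'I_T).+1.

Definition indices_of (T n : nat) (w : outcome T n) :
    'I_(theta_of w) -> 'I_n :=
  fun j => w.2 (widen_ord (ltn_ord w.1) j).
Arguments indices_of {T n} w _.

Definition uniform_pr (R : realType) (S : finType) (E : pred S) : R :=
  #|E|%:R / #|S|%:R.

(* Main.v *)
Require Import Defs.
From mathcomp Require Import all_boot all_order all_algebra.
From mathcomp Require Import boolp reals.
From mathcomp Require Import ring lra.

Set Implicit Arguments.
Unset Strict Implicit.
Unset Printing Implicit Defensive.

Import Order.TTheory GRing.Theory Num.Theory.
Local Open Scope ring_scope.

(* The potential is the expected fraction f(k) of coordinates frozen after k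
   random pins; it is nondecreasing in k with values in [0, 1]. If the matrix
   after k pins is not (delta, l)-free, then each of its more than delta * n^l
   proper relations I of size l contains a coordinate j, not yet frozen, that
   becomes frozen once I minus j is pinned. Hence
     f(k + l - 1) - f(k) >= delta * Pr[not free after k pins],
   and since the left-hand side telescopes, the sum over k = 1, ..., T of these
   probabilities is at most (l - 1) / delta. It remains to take
   T > (l - 1) / delta^2. *)

(** * Relations, frozen coordinates and pins in terms of the row space *)

Section RowSpace.
Variables (F : fieldType) (n : nat).

Lemma supp_delta (j : 'I_n) : supp (delta_mx 0 j : 'rV[F]_n) = [set j].
Proof.
by apply/setP => k; rewrite !inE mxE eqxx; case: (k == j); rewrite ?oner_eq0 ?eqxx.
Qed.

Lemma is_relationP (m : nat) (B : 'M[F]_(m, n)) (I : {set 'I_n}) :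
  reflect (exists v : 'rV[F]_n,
             [/\ (v <= B)%MS, supp v != set0 & supp v \subset I])
          (is_relation B I).
Proof.
apply: (iffP (asboolP _)) => [[_ [y [y0 yI]]]|[v [/submxP[y ->] v0 vI]]].
  by exists (y *m B); split; rewrite ?submxMl.
split; last by exists y.
by apply: contraNneq v0 => I0; rewrite -subset0 -I0.
Qed.

Lemma eqmx_is_relation (m1 m2 : nat) (B : 'M[F]_(m1, n)) (C : 'M[F]_(m2, n)) :
  (B :=: C)%MS -> is_relation B =1 is_relation C.
Proof.
by move=> eBC I; apply/is_relationP/is_relationP => -[v [vB v0 vI]];
  exists v; split; rewrite // ?eBC // -?eBC.
Qed.

Lemma eqmx_frozen (m1 m2 : nat) (B : 'M[F]_(m1, n)) (C : 'M[F]_(m2, n)) :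
  (B :=: C)%MS -> frozen B = frozen C.
Proof. by move=> eBC; apply/setP => j; rewrite !inE (eqmx_is_relation eBC). Qed.

Lemma eqmx_is_free (R : realType) (delta : R) (l m1 m2 : nat)
    (B : 'M[F]_(m1, n)) (C : 'M[F]_(m2, n)) :
  (B :=: C)%MS -> is_free delta l B = is_free delta l C.
Proof.
move=> eBC; rewrite /is_free; congr (_%:R <= _); apply: eq_card => I.
by rewrite !inE /proper_relation (eqmx_frozen eBC) (eqmx_is_relation eBC).
Qed.

Lemma mem_frozen (m : nat) (B : 'M[F]_(m, n)) (j : 'I_n) :
  (j \in frozen B) = ((delta_mx 0 j : 'rV_n) <= B)%MS.
Proof.
rewrite inE; apply/is_relationP/idP => [[v [vB v0 vj]]|jB]; last first.
  exists (delta_mx 0 j); rewrite supp_delta; split=> //.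
  by apply/set0Pn; exists j; rewrite inE.
have vjN0 : v 0 j != 0.
  by case/set0Pn: v0 => k kv; have := subsetP vj _ kv; rewrite !inE in kv * => /eqP <-.
(* The support of [v] is exactly the singleton of [j], so [v] is a non-zero multiple of the unit
   vector. *)
have -> : delta_mx 0 j = (v 0 j)^-1 *: v.
  apply/rowP => k; rewrite !mxE eqxx /=; case: (eqVneq k j) => [->|kj].
    by rewrite mulVf.
  suff /eqP-> : v 0 k == 0 by rewrite mulr0.
  have := subsetP vj k; rewrite !inE (negbTE kj).
  by case: (v 0 k == 0) => // /(_ isT).
exact: scalemx_sub.
Qed.

Lemma subset_frozen (m1 m2 : nat) (B : 'M[F]_(m1, n)) (C : 'M[F]_(m2, n)) :
  (B <= C)%MS -> frozen B \subset frozen C.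
Proof.
by move=> BC; apply/subsetP => j; rewrite !mem_frozen => /submx_trans; apply.
Qed.

Variables (m : nat) (A : 'M[F]_(m, n)).

(** Freeness depends on the row space alone, so [pin] stands in for [perturb]. Its size does not
    vary with the number of pins, and order and repetitions of the pins disappear. *)
Definition pin (S : {set 'I_n}) : 'M[F]_n :=
  (A + \sum_(j in S) <<delta_mx 0 j : 'rV[F]_n>>)%MS.

Lemma pin_sub (p : nat) (S : {set 'I_n}) (C : 'M[F]_(p, n)) :
  (A <= C)%MS -> (forall j, j \in S -> ((delta_mx 0 j : 'rV_n) <= C)%MS) ->
  (pin S <= C)%MS.
Proof.
move=> leAC SC; rewrite addsmx_sub leAC; apply/sumsmx_subP => j jS.
by rewrite genmxE SC.
Qed.

Lemma sub_pin (S : {set 'I_n}) : (A <= pin S)%MS.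
Proof. exact: addsmxSl. Qed.

Lemma delta_sub_pin (S : {set 'I_n}) (j : 'I_n) :
  j \in S -> ((delta_mx 0 j : 'rV_n) <= pin S)%MS.
Proof.
move=> jS; apply: submx_trans (addsmxSr _ _).
by apply: (sumsmx_sup j) => //; rewrite genmxE.
Qed.

Lemma pinS (S S' : {set 'I_n}) : S \subset S' -> (pin S <= pin S')%MS.
Proof.
move=> /subsetP sub; apply: pin_sub (sub_pin _) _ => j /sub.
exact: delta_sub_pin.
Qed.

Lemma perturb_eqmx (theta : nat) (i : 'I_theta -> 'I_n) :
  (perturb A i :=: pin [set i j | j : 'I_theta])%MS.
Proof.
have rowE j : row j (\matrix_(j, k) (k == i j)%:R) = delta_mx 0 (i j) :> 'rV[F]_n.
  by apply/rowP => k; rewrite !mxE.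
apply/eqmxP/andP; split.
  rewrite /perturb -addsmxE addsmx_sub sub_pin; apply/row_subP => j.
  by rewrite rowE delta_sub_pin ?imset_f.
rewrite /perturb; apply: pin_sub => [|_ /imsetP[j _ ->]]; rewrite -addsmxE.
  exact: addsmxSl.
by apply: submx_trans (addsmxSr _ _); rewrite -rowE row_sub.
Qed.

(* Pinning all of [I] except one coordinate [j] in the support of a witness
   cancels the rest of that witness. *)
Lemma proper_relation_freezes (S I : {set 'I_n}) :
  proper_relation (pin S) I ->
  exists2 j, j \in I & j \in frozen (pin (S :|: I :\ j)) :\: frozen (pin S).
Proof.
case/is_relationP => v [vS /set0Pn[j jv] /subsetP vI].
have := vI _ jv; rewrite inE => /andP[jNF jI].
exists j => //; rewrite inE jNF mem_frozen /=.
have vj : v 0 j != 0 by move: jv; rewrite inE.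
have -> : delta_mx 0 j = (v 0 j)^-1 *: (v - \sum_(k | k != j) v 0 k *: delta_mx 0 k).
  rewrite {2}(row_sum_delta v) (bigD1 j) //= addrK.
  by rewrite scalerA mulVf // scale1r.
apply: scalemx_sub; apply: addmx_sub.
  by apply: submx_trans vS (pinS _); rewrite subsetUl.
rewrite eqmx_opp; apply: summx_sub => k kj.
have [->|vk] := eqVneq (v 0 k) 0; first by rewrite scale0r sub0mx.
apply/scalemx_sub/delta_sub_pin.
have /vI : k \in supp v by rewrite inE.
by rewrite !inE kj => /andP[_ ->]; rewrite orbT.
Qed.

End RowSpace.

(** * Averages over random pins *)

Section RandomPins.
Variables (R : realType) (n : nat).
Hypothesis n_gt0 : (0 < n)%N.
Implicit Types (g : {set 'I_n} -> R) (S : {set 'I_n}).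

(** The expectation of [g] at [S] enlarged by [k] independent uniform indices. Averaging one index
    at a time makes the composition rule [pin_meanD] a plain induction. *)
Fixpoint pin_mean (k : nat) g S : R :=
  if k is k'.+1 then n%:R^-1 * \sum_(x < n) pin_mean k' g (x |: S) else g S.

Let nR_neq0 : n%:R != 0 :> R. Proof. by rewrite pnatr_eq0 -lt0n. Qed.

Lemma pin_meanD a b g S : pin_mean (a + b) g S = pin_mean a (pin_mean b g) S.
Proof.
by elim: a S => //= a IH S; congr (_ * _); apply: eq_bigr => x _; apply: IH.
Qed.

Lemma le_pin_mean k g1 g2 S :
  (forall S', g1 S' <= g2 S') -> pin_mean k g1 S <= pin_mean k g2 S.
Proof.
move=> le12; elim: k S => //= k IH S.
by apply: ler_wpM2l; [rewrite invr_ge0|apply: ler_sum].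
Qed.

Lemma pin_mean_cst k (c : R) S : pin_mean k (fun=> c) S = c.
Proof.
elim: k S => //= k IH S; under eq_bigr do rewrite IH.
by rewrite sumr_const card_ord -[c *+ n]mulr_natl mulKf.
Qed.

Lemma pin_mean_lin k (c : R) g1 g2 S :
  pin_mean k (fun S' => c * g1 S' + g2 S') S
  = c * pin_mean k g1 S + pin_mean k g2 S.
Proof.
elim: k S => //= k IH S; under eq_bigr do rewrite IH.
by rewrite big_split -mulr_sumr mulrDr mulrCA.
Qed.

Definition prefix_set (N k : nat) (w : 'I_N -> 'I_n) : {set 'I_n} :=
  [set w i | i : 'I_N & (i < k)%N].

Definition ffun_cons (N : nat) (xw : 'I_n * {ffun 'I_N -> 'I_n}) :
    {ffun 'I_N.+1 -> 'I_n} :=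
  [ffun i => if unlift ord0 i is Some j then xw.2 j else xw.1].

Lemma ffun_cons_bij (N : nat) : bijective (@ffun_cons N).
Proof.
exists (fun w : {ffun 'I_N.+1 -> 'I_n} =>
  (w ord0, [ffun j => w (lift ord0 j)])) => [[x w]|w].
  congr (_, _); first by rewrite ffunE unlift_none.
  by apply/ffunP => j; rewrite !ffunE liftK.
by apply/ffunP => i; rewrite ffunE; case: unliftP => [j|] -> //=; rewrite ffunE.
Qed.

Lemma prefix_set_cons N k x (w : {ffun 'I_N -> 'I_n}) :
  prefix_set k.+1 (ffun_cons (x, w)) = x |: prefix_set k w.
Proof.
apply/setP => z; rewrite in_setU1; apply/imsetP/predU1P => [[i]|].
  rewrite inE ltnS ffunE; case: unliftP => [j|] -> ik ->; last by left.
  by right; apply: imset_f; rewrite inE.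
case=> [->|/imsetP[j]]; first by exists ord0; rewrite ?inE // ffunE unlift_none.
by rewrite inE => jk ->; exists (lift ord0 j); rewrite ?inE // ffunE liftK.
Qed.

(** Induction on [k], splitting off the first index. The exponent is [N] and not [k], since each of
    the [N - k] indices outside the prefix is free and contributes a factor [n]. *)
Lemma sum_prefix_set N k g S : (k <= N)%N ->
  \sum_(w : {ffun 'I_N -> 'I_n}) g (S :|: prefix_set k w)
  = n%:R ^+ N * pin_mean k g S.
Proof.
elim: k N S => [|k IH] N S kN.
  under eq_bigr => w _.
    have -> : prefix_set 0 w = set0.
      by apply/setP => x; rewrite inE; apply/imsetP => -[i]; rewrite inE.
    rewrite setU0; over.
  by rewrite sumr_const card_ffun !card_ord -natrX mulr_natl.
case: N kN => // N kN; rewrite (reindex _ (onW_bij _ (ffun_cons_bij N))) /=.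
rewrite -(pair_bigA _ (fun x w => g (S :|: prefix_set k.+1 (ffun_cons (x, w))))) /=.
rewrite exprSr -mulrA mulVKf // mulr_sumr; apply: eq_bigr => x _.
by rewrite -IH //; apply: eq_bigr => w _; rewrite prefix_set_cons setUCA setUA.
Qed.

End RandomPins.

(** Raising [d] by one changes the sum by [f (T + d) - f d], which is at most 1. *)
Lemma sum_shift_le (R : realDomainType) (f : nat -> R) (d T : nat) :
  (forall k, 0 <= f k <= 1) -> \sum_(k < T) (f (k + d)%N - f k) <= d%:R.
Proof.
move=> f01; elim: d => [|d IH].
  by rewrite big1 // => k _; rewrite addn0 subrr.
have -> : \sum_(k < T) (f (k + d.+1)%N - f k)
  = \sum_(k < T) (f (k + d)%N - f k) + (f (T + d)%N - f d).
  elim: T {IH} => [|T IHT]; first by rewrite !big_ord0 subrr addr0.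
  by rewrite !big_ord_recr /= IHT addnS addSn; ring.
rewrite -natr1 lerD //.
by case/andP: (f01 (T + d)%N) => _; case/andP: (f01 d) => ? _ ?; lra.
Qed.

Section Main.
Variables (R : realType) (delta : R) (d : nat).
Variables (F : fieldType) (m n : nat) (A : 'M[F]_(m, n)).
Hypothesis n_gt0 : (0 < n)%N.

Let nR_gt0 : 0 < n%:R :> R. Proof. by rewrite ltr0n. Qed.

Definition frozen_frac (S : {set 'I_n}) : R := #|frozen (pin A S)|%:R / n%:R.

Definition not_free (S : {set 'I_n}) : bool := ~~ is_free delta d.+1 (pin A S).

Lemma frozen_frac01 (S : {set 'I_n}) : 0 <= frozen_frac S <= 1.
Proof.
rewrite divr_ge0 //= ler_pdivrMr // mul1r ler_nat.
by rewrite -[leqRHS]card_ord max_card.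
Qed.

(* Each proper relation [I] is recovered from the [d]-tuple enumerating
   [I :\ j] together with the coordinate [j] that this tuple freezes. *)
Lemma card_proper_relation_le (S : {set 'I_n}) :
  (#|[set I : {set 'I_n} | proper_relation (pin A S) I & #|I| == d.+1]|
   <= \sum_(w : {ffun 'I_d -> 'I_n})
        #|frozen (pin A (S :|: prefix_set d w)) :\: frozen (pin A S)|)%N.
Proof.
pose P := [set wj : {ffun 'I_d -> 'I_n} * 'I_n |
  wj.2 \in frozen (pin A (S :|: prefix_set d wj.1)) :\: frozen (pin A S)].
have -> : (\sum_(w : {ffun 'I_d -> 'I_n})
    #|frozen (pin A (S :|: prefix_set d w)) :\: frozen (pin A S)| = #|P|)%N.
  rewrite -[RHS]sum1_card; under [LHS]eq_bigr do rewrite -sum1_card.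
  by rewrite pair_big_dep; apply: eq_bigl => wj; rewrite [RHS]inE.
apply: leq_trans (leq_imset_card
  (fun wj : {ffun 'I_d -> 'I_n} * 'I_n => wj.2 |: prefix_set d wj.1) (mem P)).
apply/subset_leq_card/subsetP => I; rewrite inE => /andP[/proper_relation_freezes].
case=> j jI jF cI.
have cIj : #|I :\ j| = d by move: cI; rewrite (cardsD1 j) jI => /eqP[].
pose w := [ffun k : 'I_d => enum_val (cast_ord (esym cIj) k)].
have wI : prefix_set d w = I :\ j.
  apply/setP => x; apply/imsetP/idP => [[k _ ->]|xI].
    by rewrite ffunE enum_valP.
  exists (cast_ord cIj (enum_rank_in xI x)); first by rewrite inE ltn_ord.
  by rewrite ffunE cast_ordK enum_rankK_in.
apply/imsetP; exists (w, j); first by rewrite inE /= wI.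
by rewrite /= wI setD1K.
Qed.

(** Averaged over the [d] further pins, the number of newly frozen coordinates is bounded below by
    counting proper relations. *)
Lemma not_free_gain (S : {set 'I_n}) :
  delta * (not_free S)%:R + frozen_frac S <= pin_mean d frozen_frac S.
Proof.
have mono (w : {ffun 'I_d -> 'I_n}) : frozen (pin A S) \subset frozen (pin A (S :|: prefix_set d w)).
  by rewrite subset_frozen ?pinS ?subsetUl.
have sumE : \sum_(w : {ffun 'I_d -> 'I_n})
    #|frozen (pin A (S :|: prefix_set d w)) :\: frozen (pin A S)|%:R
    = n%:R ^+ d.+1 * (pin_mean d frozen_frac S - frozen_frac S) :> R.
  rewrite exprSr -mulrA [n%:R * _]mulrC mulrBl mulrBr.
  have -> : n%:R ^+ d * (pin_mean d frozen_frac S * n%:R)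
      = \sum_(w : {ffun 'I_d -> 'I_n})
          #|frozen (pin A (S :|: prefix_set d w))|%:R :> R.
    rewrite mulrA -sum_prefix_set // mulr_suml; apply: eq_bigr => w _.
    by rewrite /frozen_frac divfK ?gt_eqF.
  have -> : n%:R ^+ d * (frozen_frac S * n%:R)
      = \sum_(w : {ffun 'I_d -> 'I_n}) #|frozen (pin A S)|%:R :> R.
    by rewrite /frozen_frac divfK ?gt_eqF // sumr_const card_ffun !card_ord
      -natrX mulr_natl.
  rewrite -sumrB; apply: eq_bigr => w _.
  by rewrite cardsD (setIidPr (mono w)) natrB // subset_leq_card.
have := card_proper_relation_le S; rewrite -(ler_nat R) natr_sum sumE => le_card.
(* After scaling by [n ^ d.+1], the non-free case is the defining bound on proper relations; in the
   free case the left-hand side vanishes. *)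
rewrite -lerBrDr -(ler_pM2l (exprn_gt0 d.+1 nR_gt0)).
apply: le_trans le_card; rewrite /not_free /is_free -ltNge.
case: ltP => [/ltW|_]; first by rewrite mulr1 mulrC.
by rewrite mulr0n !mulr0.
Qed.

Lemma sum_not_free_le (T : nat) : 0 < delta ->
  delta * \sum_(k < T) pin_mean k.+1 (fun S => (not_free S)%:R) set0 <= d%:R.
Proof.
move=> delta_gt0.
(* The shift to [k.+1] matches [theta], which starts at 1. *)
pose f k := pin_mean k.+1 frozen_frac set0.
apply: le_trans (@sum_shift_le R f d T _) => [|k]; last first.
  rewrite -{1}(pin_mean_cst n_gt0 k.+1 (0 : R) set0) -(pin_mean_cst n_gt0 k.+1 (1 : R) set0).
  by rewrite !le_pin_mean // => S; case/andP: (frozen_frac01 S).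
rewrite mulr_sumr; apply: ler_sum => k _.
(* The last [d] of the [k.+1 + d] pins are averaged first, so the one-set gain applies pointwise
   under the outer mean. *)
rewrite lerBrDr -pin_mean_lin // /f -addSn pin_meanD.
exact/le_pin_mean/not_free_gain.
Qed.

End Main.

Lemma is_free_perturb (R : realType) (delta : R) (d T : nat) (F : fieldType)
    (m n : nat) (A : 'M[F]_(m, n)) (w : outcome T n) :
  is_free delta d.+1 (perturb A (indices_of w))
  = ~~ not_free delta d A (prefix_set w.1.+1 w.2).
Proof.
rewrite /not_free negbK (eqmx_is_free _ _ (perturb_eqmx _ _)).
congr (is_free _ _ (pin A _)); apply/setP => x; apply/imsetP/imsetP => -[k].
  by move=> _ ->; exists (widen_ord (ltn_ord w.1) k); rewrite ?inE /=.
by rewrite inE => kw ->; exists (Ordinal kw) => //; congr (w.2 _); apply: val_inj.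
Qed.

Theorem proposition2p4 (R : realType) (delta : R) (l : nat)
    (delta_gt0 : 0 < delta) (l_gt0 : (0 < l)%N) :
  exists T : nat, (0 < T)%N /\
    forall (F : fieldType) (m n : nat) (A : 'M[F]_(m, n)), (0 < n)%N ->
      uniform_pr R
        (fun w : outcome T n => is_free delta l (perturb A (indices_of w)))
      > 1 - delta.
Proof.
case: l l_gt0 => // d _.
(* Chosen so that [d < delta ^+ 2 * T]; the successor ensures that [T] is positive. *)
pose T := (Num.bound (d%:R / delta ^+ 2)).+1.
exists T; split=> // F m n A n_gt0.
have T_gt : d%:R < delta ^+ 2 * T%:R.
  rewrite mulrC -ltr_pdivrMr ?exprn_gt0 //.
  have /archi_boundP/lt_le_trans : 0 <= d%:R / delta ^+ 2.
    by rewrite divr_ge0 ?exprn_ge0 // ltW.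
  by apply; rewrite ler_nat.
set E := (fun w => _).
have cS : #|outcome T n|%:R = T%:R * n%:R ^+ T :> R.
  by rewrite card_prod card_ffun !card_ord natrM natrX.
have cS_gt0 : 0 < #|outcome T n|%:R :> R.
  by rewrite cS mulr_gt0 ?exprn_gt0 ?ltr0n.
have cE : #|E|%:R + #|predC E|%:R = #|outcome T n|%:R :> R.
  by rewrite -natrD cardC.
(* The bad outcomes are sorted by the value of [theta]; all values share the same [T] indices,
   whence the common factor [n ^ T]. *)
have cEC : #|predC E|%:R = n%:R ^+ T *
    \sum_(k < T) pin_mean k.+1 (fun S => (not_free delta d A S)%:R) set0 :> R.
  rewrite -sum1_card natr_sum big_mkcond mulr_sumr.
  under [RHS]eq_bigr => k _ do rewrite -sum_prefix_set //.
  rewrite pair_bigA /=; apply: eq_bigr => w _.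
  by rewrite set0U inE /E is_free_perturb negbK; case: not_free.
have := sum_not_free_le d A n_gt0 T delta_gt0.
set s := \sum_(k < T) _ in cEC * => le_s.
have s_lt : s < delta * T%:R.
  by rewrite -(ltr_pM2l delta_gt0) mulrA -expr2 (le_lt_trans le_s).
have bad_lt : #|predC E|%:R < delta * #|outcome T n|%:R :> R.
  by rewrite cEC cS [T%:R * _]mulrC mulrCA ltr_pM2l ?exprn_gt0 ?ltr0n.
by rewrite /uniform_pr ltr_pdivlMr // mulrBl mul1r; lra.
Qed.
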